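(* Let $d\ge2$, $\mathbf X\in\mathbb R^d$ elliptical with positive definite covariance $\boldsymbol\Sigma=\mathbf V\boldsymbol\Lambda\mathbf V'$, $\mathbf Y=\mathbf V'\mathbf X$, $\alpha\in(0,1)$, and for $i\in\{1,\dots,d\}$ let $\boldsymbol\Lambda_{i,\alpha}:=\mathrm{Cov}(\mathbf Y\mid Y_i\in\mathsf T^\alpha_{Y_i})$. Then: (1) $\|\boldsymbol\Lambda_{1,\alpha}\|_F\le\|\boldsymbol\Lambda_{i,\alpha}\|_F\le\|\boldsymbol\Lambda_{d,\alpha}\|_F$ for all $i$; (2) $\det(\boldsymbol\Lambda_{i,\alpha})$ is the same for all $i\in\{1,\dots,d\}$; (3) $\|\boldsymbol\Lambda_{1,\alpha}\|_{\mathrm{op}}\le\|\boldsymbol\Lambda_{i,\alpha}\|_{\mathrm{op}}$ for all $i$, and $\|\boldsymbol\Lambda_{i,\alpha}\|_{\mathrm{op}}$ takes the same value for all $i\in\{2,\dots,d\}$.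
   Context: A random vector $\mathbf X\in\mathbb R^d$ belongs to the elliptical family with parameters $(\boldsymbol\mu,\boldsymbol\Sigma,\phi)$ if its characteristic function is $\mathbb E[e^{i\mathbf t'\mathbf X}]=e^{i\mathbf t'\boldsymbol\mu}\phi(\mathbf t'\boldsymbol\Sigma\mathbf t)$ for all $\mathbf t\in\mathbb R^d$, for some scalar function $\phi$; here $\mathbf X$ is assumed to have finite second moments and covariance matrix $\boldsymbol\Sigma$, positive definite, and the conditioning events have positive probability. Spectral decomposition: $\boldsymbol\Sigma=\mathbf V\boldsymbol\Lambda\mathbf V'$ with $\mathbf V$ orthogonal (orthonormal eigenvectors as columns) and $\boldsymbol\Lambda=\mathrm{diag}(\lambda_1,\dots,\lambda_d)$, $\lambda_1\ge\cdots\ge\lambda_d>0$. For a real random variable $W$, $Q_W(p)=\inf\{x:\mathbb P(W\le x)\ge p\}$ and $\mathsf T^\alpha_W:=[Q_W(\alpha/2),Q_W(1-\alpha/2)]$. $\|\cdot\|_F$ is the Frobenius norm, $\|\cdot\|_{\mathrm{op}}$ the operator norm. *)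

(* Defs.v *)
From HB Require Import structures.
From mathcomp Require Import all_boot all_order all_algebra.
From mathcomp Require Import all_classical all_reals all_analysis.
Set Implicit Arguments. Unset Strict Implicit. Unset Printing Implicit Defensive.
Import Order.TTheory GRing.Theory Num.Theory.
Import numFieldNormedType.Exports.
Local Open Scope classical_set_scope.
Local Open Scope ring_scope.

Section defs.
Context (R : realType).

Definition dotv (n : nat) (u v : 'cV[R]_n) : R := \sum_(i < n) u i 0 * v i 0.
Definition vnorm (n : nat) (v : 'cV[R]_n) : R := Num.sqrt (dotv v v).

Definition frob_norm (n : nat) (A : 'M[R]_n) : R :=
  Num.sqrt (\sum_(i < n) \sum_(j < n) A i j ^+ 2).

Definition op_norm (n : nat) (A : 'M[R]_n) : R :=
  sup [set vnorm (A *m x) | x in [set x : 'cV[R]_n | vnorm x = 1]].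

Context (dT : measure_display) (T : measurableType dT) (P : probability T R).

Definition quantile (W : T -> R) (p : R) : R :=
  inf [set x : R | (p%:E <= P [set w | (W w <= x)%R])%E].

Definition central_interval (W : T -> R) (alpha : R) : set R :=
  `[quantile W (alpha / 2), quantile W (1 - alpha / 2)]%classic.

(* conditional expectation given an event A (with P A > 0): E[f 1_A] / P(A) *)
Definition condE (A : set T) (f : T -> R) : R :=
  fine ('E_P[f \* \1_A])%E / fine (P A).

Definition condcov (A : set T) (f g : T -> R) : R :=
  condE A (f \* g) - condE A f * condE A g.

Definition condcov_mx (n : nat) (Y : 'I_n -> T -> R) (A : set T) : 'M[R]_n :=
  \matrix_(j, k) condcov A (Y j) (Y k).

Definition rvec (n : nat) (X : 'I_n -> T -> R) (w : T) : 'cV[R]_n :=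
  \col_i X i w.

(* X is elliptical with parameters (mu, Sigma, phi): its characteristic function
   E[exp(i t'X)] equals exp(i t'mu) phi(t' Sigma t), for a scalar (complex-valued)
   function phi = phr + i phi_im.  Real and imaginary parts are written out. *)
Definition elliptical (n : nat) (X : 'I_n -> T -> R) (mu : 'cV[R]_n)
    (Sigma : 'M[R]_n) (phr phi : R -> R) : Prop :=
  forall t : 'cV[R]_n,
    let q := dotv t (Sigma *m t) in
    let m := dotv t mu in
    (\int[P]_w (cos (dotv t (rvec X w)))%:E = (cos m * phr q - sin m * phi q)%:E)%E /\
    (\int[P]_w (sin (dotv t (rvec X w)))%:E = (sin m * phr q + cos m * phi q)%:E)%E.

End defs.

(* Main.v *)
(** Let [Z_i] be the centred coordinate [Y_i] divided by [sqrt lam_i].  The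
    characteristic function of [Z] at [t] depends on [|t|] only, so the law of
    [Z] is invariant under sign changes and permutations of the coordinates, and
    [t.Z] has the same law for all unit vectors [t].  As [d >= 2], it follows
    that [Z_i] has no atom outside [0], so the conditioning event is almost
    surely [|Z_i| <= c] with the same [c] for all [i].  By the symmetries, the
    conditional covariance is diagonal, with entry [lam_i a] at [i] and [lam_j b]
    at [j <> i], for constants [a] and [b] independent of [i] and [j].  Moreover
    [0 <= a <= b], since [(Z_i^2 - c^2) (1_{|Z_j| <= c} - 1_{|Z_i| <= c}) >= 0].
    The three claims are then read off these diagonal matrices.

    Instead of the uniqueness theorem for characteristic functions, only the
    transfer of [E(1_{|Z_i| <= c} Z_j Z_k)] and the like is proved, by dominated
    convergence from trigonometric polynomials: polynomials in a cosine converge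
    boundedly to the indicator of [cos (t.z + s) > 0], these indicators converge
    to the one of a half-space as the frequency goes to [0], and
    [k sin (z / k)] converges to [z] while bounded by [|z|]. *)

Require Import Defs.
From HB Require Import structures.
From mathcomp Require Import all_boot all_order all_algebra fingroup perm.
From mathcomp Require Import all_classical all_reals all_analysis.
From mathcomp Require Import measurable_realfun.
From mathcomp Require Import ring lra.
Import Order.TTheory GRing.Theory Num.Theory.
Import numFieldNormedType.Exports.
Local Open Scope classical_set_scope.
Local Open Scope ring_scope.

Set Implicit Arguments.
Unset Strict Implicit.
Unset Printing Implicit Defensive.

(** * Bounded approximation of a threshold *)

Section threshold.
Context {R : realType}.
Implicit Types x y q : R.

Lemma bernoulli_ineq y n : 0 <= y <= 1 -> 1 - n%:R * y <= (1 - y) ^+ n.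
Proof.
move=> /andP[y0 y1]; elim: n => [|n IH]; first by rewrite mul0r subr0 expr0.
rewrite exprS; apply: (@le_trans _ _ ((1 - y) * (1 - n%:R * y))).
  have : 0 <= n%:R * y ^+ 2 by rewrite mulr_ge0 ?exprn_ge0.
  by rewrite -natr1; nra.
by apply: ler_wpM2l => //; lra.
Qed.

(** Multiply Bernoulli's inequality for [(1 + y) ^+ n] by [(1 - y) ^+ n] and use
    [(1 - y) (1 + y) <= 1]. This is the upper counterpart of [bernoulli_ineq]. *)
Lemma expr_1B_le_inv y n : 0 <= y <= 1 -> (1 - y) ^+ n <= (1 + n%:R * y)^-1.
Proof.
move=> /andP[y0 y1].
have ny0 : 0 <= n%:R * y by rewrite mulr_ge0.
have bern : 1 + n%:R * y <= (1 + y) ^+ n.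
  elim: n {ny0} => [|n IH]; first by rewrite mul0r addr0 expr0.
  rewrite exprS; apply: (@le_trans _ _ ((1 + y) * (1 + n%:R * y))).
    have : 0 <= n%:R * y ^+ 2 by rewrite mulr_ge0 ?exprn_ge0.
    by rewrite -natr1; nra.
  by apply: ler_wpM2l => //; lra.
rewrite -[leRHS]mul1r ler_pdivlMr; last by lra.
apply: (@le_trans _ _ ((1 - y) ^+ n * (1 + y) ^+ n)).
  by apply: ler_wpM2l => //; rewrite exprn_ge0//; lra.
by rewrite -exprMn exprn_ile1//; nra.
Qed.

(** Writing [q = r^2], the factor [n r^n] stays bounded and the remaining [r^n] tends to [0]. *)
Lemma cvg_natM_expr q : 0 <= q < 1 -> (n%:R * q ^+ n) @[n --> \oo] --> (0 : R).
Proof.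
move=> /andP[q0 q1]; set r := Num.sqrt q.
have r0 : 0 <= r by exact: sqrtr_ge0.
have rr : r ^+ 2 = q by rewrite sqr_sqrtr.
have r1 : r < 1 by nra.
have bnd n : n%:R * r ^+ n <= (1 - r)^-1.
  rewrite -[leRHS]mul1r ler_pdivlMr; last by lra.
  (* This form, suited to induction, is [n r^n <= 1 + r + ... + r^(n-1)] with the geometric sum
     evaluated. *)
  suff : n%:R * r ^+ n * (1 - r) <= 1 - r ^+ n.
    by move/le_trans; apply; rewrite gerBl exprn_ge0.
  elim: n => [|n IH]; first by rewrite !mul0r expr0 subrr.
  have rn : 0 <= r ^+ n by rewrite exprn_ge0.
  move: IH; rewrite exprS -natr1; move: (r ^+ n) rn (n%:R : R) (ler0n R n) => s s0 N N0.
  by move=> IH; have : 0 <= s * (1 - r) ^+ 2; [rewrite mulr_ge0 ?sqr_ge0|]; nra.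
apply: (@squeeze_cvgr _ _ _ _ (cst 0) (fun n => (1 - r)^-1 * r ^+ n)).
- apply: nearW => n; rewrite mulr_ge0 ?exprn_ge0//=.
  rewrite -rr -exprM mulnC exprM expr2 mulrA.
  by apply: ler_wpM2r; rewrite ?exprn_ge0.
- exact: cvg_cst.
- by rewrite -[0](mulr0 (1 - r)^-1); apply: cvgMl_tmp; apply: cvg_expr; rewrite ger0_norm.
Qed.

Lemma threshold_itv x n m : 0 <= x <= 1 -> 0 <= (1 - x ^+ n) ^+ m <= 1.
Proof.
move=> /andP[x0 x1].
have xn : 0 <= x ^+ n <= 1 by rewrite exprn_ge0//= exprn_ile1.
by rewrite exprn_ge0 ?exprn_ile1//; lra.
Qed.

(* The factor [n] in the exponent sends the boundary value [x = 1/2] to [0]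
   instead of [1/e]. *)
Lemma cvg_threshold x : 0 <= x <= 1 ->
  (1 - x ^+ n) ^+ (n * 2 ^ n) @[n --> \oo] --> ((x < 2^-1)%R%:R : R).
Proof.
move=> /[dup] x01 /andP[x0 x1].
have xn n : 0 <= x ^+ n <= 1 by rewrite exprn_ge0//= exprn_ile1.
(* The factor [2 ^ n] in the exponent places the threshold at [1/2]: [n (2 x)^n] tends to [0] below
   it and is at least [n] from it on. *)
have Nx n : (n * 2 ^ n)%:R * x ^+ n = n%:R * (2 * x) ^+ n.
  by rewrite natrM natrX exprMn mulrA.
case: ltP => x2 /=.
- apply: (@squeeze_cvgr _ _ _ _ (fun n => 1 - n%:R * (2 * x) ^+ n) (cst 1)).
  + apply: nearW => n; rewrite -Nx bernoulli_ineq//=.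
    by have /andP[] := threshold_itv n (n * 2 ^ n) x01.
  + rewrite -[X in _ --> X](subr0 1); apply: cvgB; first exact: cvg_cst.
    by apply: cvg_natM_expr; lra.
  + exact: cvg_cst.
- apply: (@squeeze_cvgr _ _ _ _ (cst 0) (fun n => n.+1%:R^-1)).
  + apply: nearW => n.
    have /andP[-> _] := threshold_itv n (n * 2 ^ n) x01.
    apply: (le_trans (expr_1B_le_inv _ (xn n))); rewrite Nx -[n.+1%:R]natr1 [1 + _]addrC.
    have : 1 <= (2 * x) ^+ n by apply: exprn_ege1; lra.
    move=> h; rewrite lef_pV2 ?posrE; first by rewrite lerD2r ler_peMr.
      by rewrite ltr_wpDl// mulr_ge0// (le_trans _ h).
    by rewrite ltr_wpDl.
  + exact: cvg_cst.
  + exact: cvg_harmonic.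
Qed.

End threshold.

(** * Transfer along equal characteristic functions *)

Section real_dominated_convergence.
Context (dT : measure_display) (T : measurableType dT) (R : realType).
Variable mu : {measure set T -> \bar R}.
Variables (f_ : nat -> T -> R) (f g : T -> R).
Hypothesis f_int : forall n, mu.-integrable setT (EFin \o f_ n).
Hypothesis g_int : mu.-integrable setT (EFin \o g).
Hypothesis f_le : forall n w, `|f_ n w| <= g w.
Hypothesis f_cvg : forall w, f_ n w @[n --> \oo] --> f w.

Lemma dominated_limit_integrable : mu.-integrable setT (EFin \o f).
Proof.
have mf : measurable_fun setT f.
  apply: (@measurable_fun_cvg _ _ _ _ f_) => [n|w _]; last exact: f_cvg.
  by have /measurable_int/measurable_EFinP := f_int n.
apply: le_integrable g_int => //; first exact/measurable_EFinP.
move=> w _ /=; rewrite lee_fin; apply: (le_trans _ (ler_norm _)).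
have cf : `|f_ n w| @[n --> \oo] --> `|f w| by apply: cvg_norm; exact: f_cvg.
rewrite -(cvg_lim _ cf)//; apply: limr_le; first by apply/cvg_ex; eexists; exact: cf.
by apply: nearW => n; exact: f_le.
Qed.

Lemma dominated_cvg_Rintegral :
  \int[mu]_w f_ n w @[n --> \oo] --> \int[mu]_w f w.
Proof.
apply: fine_cvg; rewrite fineK; last first.
  exact: (integrable_fin_num measurableT dominated_limit_integrable).
apply: (@dominated_cvg _ _ _ mu setT measurableT (fun n => EFin \o f_ n)
   (EFin \o f) (EFin \o g)) => //.
- by move=> n; have /measurable_int := f_int n.
- by move=> w _; apply: cvg_EFin; [exact: nearW|exact: f_cvg].
- by move=> n w _ /=; rewrite lee_fin.
Qed.

End real_dominated_convergence.

Lemma measurable_fun_cos (dT : measure_display) (T : measurableType dT)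
    (R : realType) (f : T -> R) :
  measurable_fun setT f -> measurable_fun setT (fun w => cos (f w)).
Proof.
move=> mf; apply: measurableT_comp => //.
exact: (continuous_measurable_fun (@continuous_cos R)).
Qed.

Lemma integrable_mulr_le1 (dT : measure_display) (T : measurableType dT)
    (R : realType) (mu : {measure set T -> \bar R}) (f h : T -> R) :
  mu.-integrable setT (EFin \o f) -> measurable_fun setT h ->
  (forall w, `|h w| <= 1) -> mu.-integrable setT (EFin \o (fun w => f w * h w)).
Proof.
move=> fi mh h1.
have mf : measurable_fun setT f by have /measurable_int/measurable_EFinP := fi.
apply: le_integrable fi => //.
  by apply/measurable_EFinP; exact: measurable_funM.
by move=> w _ /=; rewrite lee_fin normrM ler_piMr.
Qed.

(** The bound on the intermediate point is kept because [cvg_natM_sin_div] needs [cos c] to be close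
    to [1]. *)
Lemma sin_MVT (R : realType) (x : R) :
  exists2 c : R, `|c| <= `|x| & sin x = cos c * x.
Proof.
have dsin (a b y : R) : y \in `]a, b[ -> is_derive y 1 sin (cos y).
  by move=> _; exact: is_derive_sin.
have csin (a b : R) : {within `[a, b], continuous (@sin R)}.
  by apply: continuous_subspaceT => y; exact: continuous_sin.
have [x0|x0] := leP 0 x.
  have [c] := MVT_segment x0 (@dsin 0 x) (@csin 0 x).
  rewrite in_itv/= sin0 !subr0 => /andP[c0 cx] ->.
  by exists c => //; rewrite !ger0_norm.
have [c] := MVT_segment (ltW x0) (@dsin x 0) (@csin x 0).
rewrite in_itv/= sin0 !sub0r mulrN => /andP[cx c0] /oppr_inj ->.
by exists c => //; rewrite ler0_norm// ltr0_norm// lerN2.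
Qed.

Lemma ler_norm_sin (R : realType) (x : R) : `|sin x| <= `|x|.
Proof.
have [c _ ->] := sin_MVT x.
by rewrite normrM ler_piMl// cos_max.
Qed.

(** Write [k] for [k.+1]. By [sin_MVT] the error is [x (1 - cos c)] with [|c| <= |x| / k], and
    [1 - cos c = 2 sin^2 (c / 2) <= c^2], so it is at most [|x|^3 / k^2]. The weaker bound
    [|x|^3 / k] is used, so that the harmonic sequence applies. *)
Lemma cvg_natM_sin_div (R : realType) (x : R) :
  k.+1%:R * sin (x / k.+1%:R) @[k --> \oo] --> x.
Proof.
apply/subr_cvg0.
apply: (@squeeze_cvgr _ _ _ _ (fun k => - (`|x| ^+ 3 * k.+1%:R^-1))
                              (fun k => `|x| ^+ 3 * k.+1%:R^-1)).
- apply: nearW => k; rewrite -ler_norml.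
  have k0 : 0 < k.+1%:R :> R by [].
  have [c cx ->] := sin_MVT (x / k.+1%:R).
  have -> : k.+1%:R * (cos c * (x / k.+1%:R)) - x = - (x * (1 - cos c)) by field.
  have c1 : 1 - cos c <= c ^+ 2.
    have -> : 1 - cos c = sin (c / 2) ^+ 2 *+ 2.
      have := cos_mulr2n (c / 2); rewrite -[_ *+ 2 in LHS]mulr_natr divfK ?pnatr_eq0// => ->.
      by rewrite sin2cos2; ring.
    have := ler_norm_sin (c / 2).
    rewrite -ler_sqr ?nnegrE// !real_normK ?num_real// exprMn.
    have : 0 <= c ^+ 2 by exact: sqr_ge0.
    by rewrite -mulr_natr; lra.
  rewrite normrN normrM exprS -mulrA; apply: ler_wpM2l => //.
  rewrite ger0_norm; last by rewrite subr_ge0 cos_le1.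
  apply: (le_trans c1); rewrite -real_normK ?num_real//.
  apply: (@le_trans _ _ ((`|x| / k.+1%:R) ^+ 2)).
    rewrite ler_sqr ?nnegrE ?divr_ge0//.
    by move: cx; rewrite normrM [X in _ * X]gtr0_norm ?invr_gt0.
  rewrite exprMn; apply: ler_wpM2l; first exact: sqr_ge0.
  by rewrite expr2 ler_piMl ?invr_ge0// invf_le1// ler1n.
- rewrite -oppr0; apply: cvgN; rewrite -[X in _ --> X](mulr0 (`|x| ^+ 3)).
  by apply: cvgMl_tmp; exact: cvg_harmonic.
- rewrite -[X in _ --> X](mulr0 (`|x| ^+ 3)).
  by apply: cvgMl_tmp; exact: cvg_harmonic.
Qed.

Section transfer.
Context (dT : measure_display) (T : measurableType dT) (R : realType).
Variables (P : probability T R) (n : nat).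

Definition lin (Z : 'I_n -> T -> R) (t : 'I_n -> R) (w : T) : R :=
  \sum_i t i * Z i w.

Lemma measurable_lin Z t :
  (forall i, measurable_fun setT (Z i)) -> measurable_fun setT (lin Z t).
Proof. by move=> mZ; apply: measurable_sum => i; exact: measurable_funM. Qed.

Lemma linD Z s t w : lin Z (fun i => s i + t i) w = lin Z s w + lin Z t w.
Proof. by rewrite /lin -big_split; apply: eq_bigr => i _; rewrite mulrDl. Qed.

Lemma linZ Z c t w : lin Z (fun i => c * t i) w = c * lin Z t w.
Proof. by rewrite /lin mulr_sumr; apply: eq_bigr => i _; rewrite mulrA. Qed.

Lemma lin0 Z w : lin Z (fun=> 0) w = 0.
Proof. by rewrite /lin big1// => i _; rewrite mul0r. Qed.

Lemma lin1 Z i w : lin Z (fun k => (k == i)%:R) w = Z i w.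
Proof.
rewrite /lin (bigD1 i)//= eqxx mul1r big1 ?addr0// => k /negbTE->.
by rewrite mul0r.
Qed.

Variables Z Z' : 'I_n -> T -> R.
Hypothesis mZ : forall i, measurable_fun setT (Z i).
Hypothesis mZ' : forall i, measurable_fun setT (Z' i).

(* Meant for [f] and [f'] that are the same function of [Z] and of [Z']. *)
Definition matched (f f' : T -> R) : Prop :=
  [/\ P.-integrable setT (EFin \o f), P.-integrable setT (EFin \o f') &
  forall t s, \int[P]_w (f w * cos (lin Z t w + s)) =
              \int[P]_w (f' w * cos (lin Z' t w + s))].

Let mcos t s : measurable_fun setT (fun w => cos (lin Z t w + s)).
Proof. by apply/measurable_fun_cos/measurable_funD => //; exact: measurable_lin. Qed.

Let mcos' t s : measurable_fun setT (fun w => cos (lin Z' t w + s)).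
Proof. by apply/measurable_fun_cos/measurable_funD => //; exact: measurable_lin. Qed.

(** Take [t = 0] and [s = 0], where the cosine is [1]. Every equality of probabilities or moments is
    read off in this way. *)
Lemma matched_Rintegral f f' : matched f f' -> \int[P]_w f w = \int[P]_w f' w.
Proof.
move=> [_ _ /(_ (fun=> 0) 0)].
under eq_Rintegral do rewrite lin0 addr0 cos0 mulr1.
by under [in RHS]eq_Rintegral do rewrite lin0 addr0 cos0 mulr1.
Qed.

Lemma eq_matched f f' g g' : f =1 g -> f' =1 g' -> matched f f' -> matched g g'.
Proof. by move=> /funext<- /funext<-. Qed.

Lemma matchedD f f' g g' : matched f f' -> matched g g' ->
  matched (fun w => f w + g w) (fun w => f' w + g' w).
Proof.
move=> [fi fi' ff] [gi gi' gg]; split; [exact: (integrableD measurableT fi gi)|exact: (integrableD measurableT fi' gi')|].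
move=> t s.
under eq_Rintegral do rewrite mulrDl.
under [in RHS]eq_Rintegral do rewrite mulrDl.
by rewrite !RintegralD// ?ff ?gg//; apply: integrable_mulr_le1 => // w; exact: cos_max.
Qed.

Lemma matchedZ c f f' : matched f f' ->
  matched (fun w => c * f w) (fun w => c * f' w).
Proof.
move=> [fi fi' ff]; split; [exact: (integrableZl measurableT c fi)|exact: (integrableZl measurableT c fi')|].
move=> t s.
under eq_Rintegral do rewrite -mulrA.
under [in RHS]eq_Rintegral do rewrite -mulrA.
by rewrite !RintegralZl// ?ff//; apply: integrable_mulr_le1 => // w; exact: cos_max.
Qed.

(** A product of two cosines is half the sum of the cosines with frequencies [t + t'] and [t - t']
    and phases [s + s'] and [s - s']. The class is closed because [matched] ranges over all
    frequencies and phases. *)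
Lemma matchedM_cos t s f f' : matched f f' ->
  matched (fun w => f w * cos (lin Z t w + s))
          (fun w => f' w * cos (lin Z' t w + s)).
Proof.
move=> [fi fi' ff]; split.
- by apply: integrable_mulr_le1 => // w; exact: cos_max.
- by apply: integrable_mulr_le1 => // w; exact: cos_max.
move=> t' s'.
have prod (U : 'I_n -> T -> R) (h : T -> R) w :
    h w * cos (lin U t w + s) * cos (lin U t' w + s') =
    2^-1 * (h w * cos (lin U (fun i => t i + t' i) w + (s + s')) +
            h w * cos (lin U (fun i => t i + -1 * t' i) w + (s - s'))).
  rewrite !linD linZ.
  have -> : lin U t w + lin U t' w + (s + s') = (lin U t w + s) + (lin U t' w + s').
    by ring.
  have -> : lin U t w + -1 * lin U t' w + (s - s') = (lin U t w + s) - (lin U t' w + s').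
    by ring.
  by move: (lin U t w + s) (lin U t' w + s') => a b; rewrite cosD cosB; field.
under eq_Rintegral do rewrite prod.
under [in RHS]eq_Rintegral do rewrite prod.
have ci U h v r : P.-integrable setT (EFin \o h) -> (forall i, measurable_fun setT (U i)) ->
    P.-integrable setT (EFin \o (fun w => h w * cos (lin U v w + r))).
  move=> hi mU; apply: integrable_mulr_le1 => // [|w]; last exact: cos_max.
  by apply/measurable_fun_cos/measurable_funD => //; exact: measurable_lin.
rewrite !RintegralZl//; try by apply: (integrableD measurableT (ci _ _ _ _ _ _) (ci _ _ _ _ _ _)).
by congr (_ * _); rewrite !RintegralD ?ff//; exact: ci.
Qed.

(** Multiplying by a cosine preserves the dominating functions, so dominated convergence applies on
    both sides for each [t] and [s], and equal sequences have equal limits. *)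
Lemma matched_limit f f' (f_ f_' : nat -> T -> R) g g' :
  (forall k, matched (f_ k) (f_' k)) ->
  P.-integrable setT (EFin \o g) -> P.-integrable setT (EFin \o g') ->
  (forall k w, `|f_ k w| <= g w) -> (forall k w, `|f_' k w| <= g' w) ->
  (forall w, f_ k w @[k --> \oo] --> f w) ->
  (forall w, f_' k w @[k --> \oo] --> f' w) -> matched f f'.
Proof.
move=> ff gi gi' fg fg' cf cf'.
have fi k : P.-integrable setT (EFin \o f_ k) by have [] := ff k.
have fi' k : P.-integrable setT (EFin \o f_' k) by have [] := ff k.
split; [exact: dominated_limit_integrable gi fg cf
       |exact: dominated_limit_integrable gi' fg' cf'|].
move=> t s.
have c : \int[P]_w (f_ k w * cos (lin Z t w + s)) @[k --> \oo] -->
         \int[P]_w (f w * cos (lin Z t w + s)).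
  apply: (dominated_cvg_Rintegral _ gi) => [k|k w|w].
  - by apply: integrable_mulr_le1 => // w; exact: cos_max.
  - by rewrite normrM (le_trans _ (fg k w))// ler_piMr// cos_max.
  - by apply: cvgMr_tmp; exact: cf.
have c' : \int[P]_w (f_' k w * cos (lin Z' t w + s)) @[k --> \oo] -->
          \int[P]_w (f' w * cos (lin Z' t w + s)).
  apply: (dominated_cvg_Rintegral _ gi') => [k|k w|w].
  - by apply: integrable_mulr_le1 => // w; exact: cos_max.
  - by rewrite normrM (le_trans _ (fg' k w))// ler_piMr// cos_max.
  - by apply: cvgMr_tmp; exact: cf'.
apply: (cvg_unique _ c); first exact: norm_hausdorff.
rewrite (_ : (fun k => _) = (fun k => \int[P]_w (f_' k w * cos (lin Z' t w + s))))//.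
by apply/funext => k; have [_ _ ->] := ff k.
Qed.

Lemma matchedM_threshold t s k m f f' : matched f f' ->
  matched (fun w => f w * (1 - (2^-1 * (1 - cos (lin Z t w + s))) ^+ k) ^+ m)
          (fun w => f' w * (1 - (2^-1 * (1 - cos (lin Z' t w + s))) ^+ k) ^+ m).
Proof.
move=> ff; elim: m => [|m IH].
  by apply: eq_matched ff => w; rewrite expr0 mulr1.
(* The pair [g], [g'] is arbitrary because the outer induction applies this to the product already
   built. *)
have pow j g g' : matched g g' ->
   matched (fun w => g w * (2^-1 * (1 - cos (lin Z t w + s))) ^+ j)
           (fun w => g' w * (2^-1 * (1 - cos (lin Z' t w + s))) ^+ j).
  move=> gg; elim: j => [|j IHj]; first by apply: eq_matched gg => w; rewrite expr0 mulr1.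
  have := matchedZ 2^-1 (matchedD IHj (matchedZ (-1) (matchedM_cos t s IHj))).
  by apply: eq_matched => w /=; rewrite exprS; ring.
have := matchedD IH (matchedZ (-1) (pow k _ _ IH)).
by apply: eq_matched => w /=; rewrite exprS; ring.
Qed.

(** The number [(1 - cos) / 2] lies in [[0, 1]] and is below [1/2] exactly when the cosine is
    positive. The approximating polynomials take values in [[0, 1]], so [|f|] dominates. *)
Lemma matchedM_cos_gt0 t s f f' : matched f f' ->
  matched (fun w => f w * (0 < cos (lin Z t w + s))%R%:R)
          (fun w => f' w * (0 < cos (lin Z' t w + s))%R%:R).
Proof.
move=> ff; have [fi fi' _] := ff.
have x01 (c : R) : `|c| <= 1 -> 0 <= 2^-1 * (1 - c) <= 1.
  by rewrite ler_norml => /andP[c1 c2]; apply/andP; split; lra.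
have lt01 (c : R) : (0 < c) = (2^-1 * (1 - c) < 2^-1).
  by apply/idP/idP; lra.
apply: (@matched_limit _ _
  (fun k w => f w * (1 - (2^-1 * (1 - cos (lin Z t w + s))) ^+ k) ^+ (k * 2 ^ k))
  (fun k w => f' w * (1 - (2^-1 * (1 - cos (lin Z' t w + s))) ^+ k) ^+ (k * 2 ^ k))
  (Num.norm \o f) (Num.norm \o f')).
- by move=> k; exact: matchedM_threshold.
- exact: integrable_norm.
- exact: integrable_norm.
- move=> k w; rewrite normrM ler_piMr//.
  have /andP[h0 h1] := threshold_itv k (k * 2 ^ k) (x01 _ (cos_max (lin Z t w + s))).
  by rewrite ger0_norm.
- move=> k w; rewrite normrM ler_piMr//.
  have /andP[h0 h1] := threshold_itv k (k * 2 ^ k) (x01 _ (cos_max (lin Z' t w + s))).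
  by rewrite ger0_norm.
- by move=> w; apply: cvgMl_tmp; rewrite lt01; apply/cvg_threshold/x01/cos_max.
- by move=> w; apply: cvgMl_tmp; rewrite lt01; apply/cvg_threshold/x01/cos_max.
Qed.

(* [cos (x / k - pi / 2) = sin (x / k)] has the sign of [x] once [|x| < k pi]. *)
Lemma cvg_cos_gt0 (x : R) :
  (0 < cos (x / k.+1%:R - pi / 2))%R%:R @[k --> \oo] --> ((0 < x)%R%:R : R).
Proof.
apply: cvg_near_cst; near=> k; rewrite cosBpihalf.
have k0 : 0 < k.+1%:R :> R by [].
have xk : `|x| / k.+1%:R < pi.
  rewrite ltr_pdivrMr//; apply: (@lt_le_trans _ _ k.+1%:R); last first.
    by rewrite ler_peMl//; have := pi_ge2 R; lra.
  by rewrite (@lt_le_trans _ _ k%:R) ?ler_nat//; near: k; exact: nbhs_infty_gtr.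
congr (_%:R); apply: congr1; case: (ltrgtP 0 x) => x0.
- apply/sin_gt0_pi; rewrite divr_gt0//=.
  by move: xk; rewrite gtr0_norm.
- apply/negbTE; rewrite -leNgt -[x]opprK mulNr sinN oppr_le0.
  apply/ltW/sin_gt0_pi; rewrite divr_gt0 ?oppr_gt0//=.
  by move: xk; rewrite ltr0_norm.
- by rewrite -x0 mul0r sin0 ltxx.
Unshelve. all: by end_near. Qed.

(** With frequency [- t / k] and phase [a / k - pi / 2] the cosine is [sin ((a - t.Z) / k)], which
    for large [k] is positive exactly when [t.Z < a]. *)
Lemma matchedM_lt t a f f' : matched f f' ->
  matched (fun w => f w * (lin Z t w < a)%R%:R) (fun w => f' w * (lin Z' t w < a)%R%:R).
Proof.
move=> ff; have [fi fi' _] := ff.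
have phase U w k : lin U (fun i => - k.+1%:R^-1 * t i) w + (a / k.+1%:R - pi / 2) =
    (a - lin U t w) / k.+1%:R - pi / 2.
  by rewrite linZ; ring.
have le1 (b : bool) : `|b%:R : R| <= 1 by case: b; rewrite ?normr1 ?normr0.
apply: (@matched_limit _ _
  (fun k w => f w * (0 < cos ((a - lin Z t w) / k.+1%:R - pi / 2))%R%:R)
  (fun k w => f' w * (0 < cos ((a - lin Z' t w) / k.+1%:R - pi / 2))%R%:R)
  (Num.norm \o f) (Num.norm \o f')).
- move=> k; have := matchedM_cos_gt0 (fun i => - k.+1%:R^-1 * t i)
    (a / k.+1%:R - pi / 2) ff.
  by apply: eq_matched => w; rewrite phase.
- exact: integrable_norm.
- exact: integrable_norm.
- by move=> k w; rewrite normrM ler_piMr.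
- by move=> k w; rewrite normrM ler_piMr.
- by move=> w; apply: cvgMl_tmp; rewrite -subr_gt0; exact: cvg_cos_gt0.
- by move=> w; apply: cvgMl_tmp; rewrite -subr_gt0; exact: cvg_cos_gt0.
Qed.

(** The closed half-space is the complement of the open half-space [- t.Z < - a]. *)
Lemma matchedM_le t a f f' : matched f f' ->
  matched (fun w => f w * (lin Z t w <= a)%R%:R) (fun w => f' w * (lin Z' t w <= a)%R%:R).
Proof.
move=> ff.
have := matchedD ff (matchedZ (-1) (matchedM_lt (fun i => -1 * t i) (- a) ff)).
by apply: eq_matched => w /=; rewrite linZ (mulN1r (lin _ _ _)) ltrN2 leNgt; case: ltP => _ /=; ring.
Qed.

(** A sine is a shifted cosine, so [k sin (Z_i / k)] is an admissible factor. It is bounded by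
    [|Z_i|], and the assumed integrability of [f Z_i] and [f' Z'_i] provides the domination as [k]
    grows. *)
Lemma matchedM_coord i f f' : matched f f' ->
  P.-integrable setT (EFin \o (fun w => f w * Z i w)) ->
  P.-integrable setT (EFin \o (fun w => f' w * Z' i w)) ->
  matched (fun w => f w * Z i w) (fun w => f' w * Z' i w).
Proof.
move=> ff fi fi'.
have bound (U : T -> R) (h : T -> R) k w :
    `|h w * (k.+1%:R * sin (U w / k.+1%:R))| <= `|h w * U w|.
  rewrite !normrM; apply: ler_wpM2l => //.
  rewrite (ger0_norm (ler0n _ _)) -ler_pdivlMl// [leRHS]mulrC.
  by apply: (le_trans (ler_norm_sin _)); rewrite normrM [X in _ * X]gtr0_norm ?invr_gt0.
apply: (@matched_limit _ _
  (fun k w => f w * (k.+1%:R * sin (Z i w / k.+1%:R)))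
  (fun k w => f' w * (k.+1%:R * sin (Z' i w / k.+1%:R)))
  (Num.norm \o (fun w => f w * Z i w)) (Num.norm \o (fun w => f' w * Z' i w))).
- move=> k.
  have := matchedZ k.+1%:R (matchedM_cos (fun j => k.+1%:R^-1 * (j == i)%:R) (- (pi / 2)) ff).
  by apply: eq_matched => w /=; rewrite linZ lin1 cosBpihalf mulrCA [_^-1 * _]mulrC.
- exact: integrable_norm.
- exact: integrable_norm.
- by move=> k w; exact: bound.
- by move=> k w; exact: bound.
- by move=> w; apply: cvgMl_tmp; exact: cvg_natM_sin_div.
- by move=> w; apply: cvgMl_tmp; exact: cvg_natM_sin_div.
Qed.

End transfer.

(** * Quantiles *)

Section probability_of_bool.
Context (dT : measure_display) (T : measurableType dT) (R : realType).
Variable P : probability T R.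
Implicit Types b : T -> bool.

(** An integral rather than a measure, so that [matched_Rintegral] and dominated convergence apply
    to it directly. *)
Definition prb b : R := \int[P]_w (b w)%:R.

Lemma measurable_bool_set b : measurable_fun setT b -> measurable [set w | b w].
Proof.
move=> mb; rewrite (_ : [set w | b w] = setT `&` b @^-1` [set true]); last first.
  by rewrite setTI; apply/seteqP; split.
exact: mb.
Qed.

Lemma bool_indic b w : (b w)%:R = \1_[set w | b w] w :> R.
Proof. by rewrite indicE; congr ((nat_of_bool _)%:R); apply/idP/idP; rewrite inE. Qed.

Lemma integrable_bool b : measurable_fun setT b ->
  P.-integrable setT (EFin \o (fun w => (b w)%:R)).
Proof.
move=> mb; rewrite (_ : (fun w => _) = \1_[set w | b w]); last first.
  by apply/funext => w; rewrite bool_indic.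
by apply: integrable_indic => //; exact: measurable_bool_set.
Qed.

Lemma prbE b : measurable_fun setT b -> P [set w | b w] = (prb b)%:E.
Proof.
move=> mb; rewrite /prb /Rintegral.
under eq_integral do rewrite bool_indic.
rewrite integral_indic ?setIT//; last exact: measurable_bool_set.
rewrite fineK// fin_num_measure//; exact: measurable_bool_set.
Qed.

Lemma prb_le b b' : measurable_fun setT b -> measurable_fun setT b' ->
  (forall w, b w -> b' w) -> prb b <= prb b'.
Proof.
move=> mb mb' bb'; apply: le_Rintegral => //; try exact: integrable_bool.
by move=> w _; rewrite ler_nat; have := bb' w; case: (b w); case: (b' w) => // /(_ isT).
Qed.

Lemma prb_ge0 b : 0 <= prb b.
Proof. exact: Rintegral_ge0. Qed.

Lemma prb_true : prb (fun=> true) = 1.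
Proof. by rewrite /prb Rintegral_cst//= [P _](@probability_setT _ _ _ P) mul1r. Qed.

Lemma prb_false : prb (fun=> false) = 0.
Proof. by rewrite /prb Rintegral_cst// mul0r. Qed.

(** The single equation in [nat] encodes both disjointness and union. *)
Lemma prbU b1 b2 b : measurable_fun setT b1 -> measurable_fun setT b2 ->
  (forall w, (b w : nat) = (b1 w + b2 w)%N) -> prb b = prb b1 + prb b2.
Proof.
move=> m1 m2 h; rewrite /prb -RintegralD//; try exact: integrable_bool.
by apply: eq_Rintegral => w _; rewrite h natrD.
Qed.

Lemma prb_cvg (b : nat -> T -> bool) b0 : (forall k, measurable_fun setT (b k)) ->
  (forall w, \forall k \near \oo, b k w = b0 w) -> prb (b k) @[k --> \oo] --> prb b0.
Proof.
move=> mb bb; apply: (@dominated_cvg_Rintegral _ _ _ _ _ _ (cst 1)).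
- by move=> k; exact: integrable_bool.
- exact: finite_measure_integrable_cst.
- by move=> k w /=; case: (b k w); rewrite ?normr1 ?normr0.
- move=> w; apply: cvg_near_cst; near=> k.
  by congr (_%:R); apply: congr1; near: k; exact: bb.
Unshelve. all: by end_near. Qed.

Variables (W : T -> R).
Hypothesis mW : measurable_fun setT W.

Let mle x : measurable_fun setT (fun w => W w <= x).
Proof. exact: measurable_fun_ler. Qed.

Let mlt x : measurable_fun setT (fun w => W w < x).
Proof. exact: measurable_fun_ltr. Qed.

Lemma quantile_setE p :
  [set x : R | (p%:E <= P [set w | (W w <= x)%R])%E] =
  [set x : R | p <= prb (fun w => W w <= x)].
Proof. by apply/seteqP; split => x /=; rewrite prbE// lee_fin. Qed.

(** The limits of the distribution function at both infinities make the defining set nonempty and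
    bounded below, so [inf] is a genuine infimum; right-continuity shows that it is attained. *)
Lemma quantile_min p : 0 < p < 1 ->
  p <= prb (fun w => W w <= quantile P W p) /\
  forall x, p <= prb (fun w => W w <= x) -> quantile P W p <= x.
Proof.
move=> /andP[p0 p1]; rewrite /quantile quantile_setE; set S := [set x | _].
have S0 : S !=set0.
  have : prb (fun w => W w <= k%:R) @[k --> \oo] --> prb (fun=> true).
    by apply: prb_cvg => // w; near=> k; apply: ltW; near: k; exact: nbhs_infty_gtr.
  rewrite prb_true => /cvgr_gt/(_ _ p1)[k _ /(_ k (leqnn _)) /= h].
  by exists k%:R; rewrite /S/= ltW.
have Sb : has_lbound S.
  have : prb (fun w => W w <= - k%:R) @[k --> \oo] --> prb (fun=> false).
    apply: prb_cvg => // w; near=> k; apply/negbTE; rewrite -ltNge ltrNl.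
    by near: k; exact: nbhs_infty_gtr.
  rewrite prb_false => /cvgr_lt/(_ _ p0)[k _ /(_ k (leqnn _)) /= h].
  exists (- k%:R) => x /= Sx; rewrite leNgt; apply/negP => xk.
  have : prb (fun w => W w <= x) <= prb (fun w => W w <= - k%:R).
    by apply: prb_le => // w /le_trans; apply; exact: ltW.
  by move=> /(le_trans Sx); rewrite leNgt h.
split; last by move=> x Sx; exact: ge_inf.
have c : prb (fun w => W w <= inf S + k.+1%:R^-1) @[k --> \oo] -->
    prb (fun w => W w <= inf S).
  apply: prb_cvg => // w; have [Wi|] := leP (W w) (inf S).
    by apply: nearW => k; rewrite (le_trans Wi)// lerDl.
  rewrite -subr_gt0 => Wi; near=> k; apply/negbTE; rewrite -ltNge -ltrBrDl.
  by near: k; exact: (cvgr_lt _ cvg_harmonic _ Wi).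
rewrite -(cvg_lim _ c)//; apply: limr_ge; first by apply/cvg_ex; eexists; exact: c.
apply: nearW => k.
have [x Sx xk] := @inf_adherent _ S k.+1%:R^-1 ltac:(by rewrite invr_gt0) (conj S0 Sb).
by apply: (le_trans Sx); apply: prb_le => // w /le_trans; apply; exact: ltW.
Unshelve. all: by end_near. Qed.

(** The event is the limit of [W <= q - 1 / k], and each of these has probability below [p] by
    minimality of [q]. *)
Lemma prb_lt_quantile p : 0 < p < 1 -> prb (fun w => W w < quantile P W p) <= p.
Proof.
move=> p01; have [_ qmin] := quantile_min p01; set q := quantile P W p.
have c : prb (fun w => W w <= q - k.+1%:R^-1) @[k --> \oo] --> prb (fun w => W w < q).
  apply: prb_cvg => // w; have [|Wq] := ltP (W w) q; last first.
    by apply: nearW => k; apply/negbTE; rewrite -ltNge (lt_le_trans _ Wq)// gtrBl.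
  rewrite -subr_gt0 => Wq; near=> k; rewrite lerBrDr -lerBrDl; apply: ltW.
  by near: k; exact: (cvgr_lt _ cvg_harmonic _ Wq).
rewrite -(cvg_lim _ c)//; apply: limr_le; first by apply/cvg_ex; eexists; exact: c.
apply: nearW => k; rewrite leNgt; apply/negP => /ltW /qmin.
by rewrite leNgt gtrBl invr_gt0 ltr0n.
Unshelve. all: by end_near. Qed.

(* A flat stretch of the distribution function at level [alpha / 2] makes the
   left end point of the central interval smaller than the opposite of the right
   one; without atoms, the difference carries no mass. *)
Lemma central_interval_sym (alpha : R) : 0 < alpha < 1 ->
  (forall x, prb (fun w => W w <= x) = prb (fun w => - W w <= x)) ->
  (forall u : R, u != 0 -> prb (fun w => W w == u) = 0) ->
  {ae P, forall w, central_interval P W alpha (W w) <->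
                   `|W w| <= quantile P W (1 - alpha / 2)}.
Proof.
move=> /andP[a0 a1] sym atom.
have pl : 0 < alpha / 2 < 1 by lra.
have pc : 0 < 1 - alpha / 2 < 1 by lra.
have [l1 l2] := quantile_min pl; have [c1 c2] := quantile_min pc.
have c3 := prb_lt_quantile pc.
move: c1 c2 c3 l1 l2; rewrite /central_interval.
set l := quantile P W (alpha / 2); set c := quantile P W (1 - alpha / 2).
move=> c1 c2 c3 l1 l2.
have mNle (x : R) : measurable_fun setT (fun w => - W w <= x).
  by apply: measurable_fun_ler => //; exact: measurableT_comp.
have meq x : measurable_fun setT (fun w => W w == x) by exact: measurable_fun_eqr.
(* For [c < 0] the events [W <= c] and [- W <= c] would be disjoint, each of mass at least
   [1 - alpha / 2 > 1/2]. *)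
have c0 : 0 <= c.
  rewrite leNgt; apply/negP => c0.
  have : prb (fun w => W w <= c) + prb (fun w => - W w <= c) <= 1.
    rewrite -prb_true -(@prbU _ _ (fun w => (W w <= c) || (- W w <= c)))//.
      by apply: prb_le => //; exact: measurable_or.
    by move=> w; case: (leP (W w) c) => h1; case: (leP (- W w) c) => h2 //; exfalso; lra.
  by rewrite -sym; lra.
have lc : l <= - c.
  apply: l2; rewrite sym.
  suff : 1 = prb (fun w => W w < c) + prb (fun w => - W w <= - c) by lra.
  by rewrite -prb_true; apply: prbU => // w; rewrite lerN2; case: ltP.
have Nlt : prb (fun w => W w < - c) <= alpha / 2.
  have -> : prb (fun w => W w < - c) = 1 - prb (fun w => W w <= c).
    suff : 1 = prb (fun w => - W w <= c) + prb (fun w => W w < - c) by rewrite -sym; lra.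
    by rewrite -prb_true; apply: prbU => // w; rewrite lerNl; case: leP.
  by lra.
have null : prb (fun w => l <= W w < - c) = 0.
  have mb : measurable_fun setT (fun w => l <= W w < - c).
    by apply: measurable_and => //; exact: measurable_fun_ler.
  have [lc'|lc'] := ltP l (- c); last first.
    rewrite (_ : (fun w => _) = (fun=> false)) ?prb_false//.
    by apply/funext => w; apply/negbTE/negP => /andP[h1 h2]; lra.
  have l0 : l != 0 by lra.
  have e1 : prb (fun w => W w < - c) = prb (fun w => W w < l) + prb (fun w => l <= W w < - c).
    apply: prbU => // w; case: (ltP (W w) l) => h1 /=; last by [].
    by rewrite (lt_trans h1 lc').
  have e2 : prb (fun w => W w <= l) = prb (fun w => W w < l) + prb (fun w => W w == l).
    by apply: prbU => // w; case: (ltgtP (W w) l).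
  rewrite (atom _ l0) in e2; apply/eqP; rewrite eq_le prb_ge0 andbT.
  by lra.
exists [set w | l <= W w < - c]; split.
- by apply: measurable_bool_set; apply: measurable_and => //; exact: measurable_fun_ler.
- rewrite prbE ?null//.
  by apply: measurable_and => //; exact: measurable_fun_ler.
move=> w /=; apply: contra_notP => /negP h; rewrite in_itv/= ler_norml.
split=> /andP[h1 h2]; rewrite h2 andbT; last exact: le_trans h1.
by move: h; rewrite h1 /= -leNgt.
Qed.

End probability_of_bool.

Section affine_quantile.
Context (dT : measure_display) (T : measurableType dT) (R : realType).
Variables (P : probability T R) (W : T -> R) (m s : R).
Hypothesis mW : measurable_fun setT W.
Hypothesis s0 : 0 < s.

Let mY : measurable_fun setT (fun w => m + s * W w).
Proof. by apply: measurable_funD => //; exact: measurable_funM. Qed.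

Lemma quantile_affine p : 0 < p < 1 ->
  quantile P (fun w => m + s * W w) p = m + s * quantile P W p.
Proof.
move=> p01; have [Y1 Y2] := quantile_min P mY p01.
have [W1 W2] := quantile_min P mW p01.
have YW x : prb P (fun w => m + s * W w <= x) = prb P (fun w => W w <= (x - m) / s).
  congr (prb P _); apply/funext => w.
  by rewrite ler_pdivlMr// mulrC lerBrDl.
apply/eqP; rewrite eq_le; apply/andP; split.
- by apply: Y2; rewrite YW addrAC subrr add0r mulrC mulKf ?gt_eqF.
- by rewrite -lerBrDl mulrC -ler_pdivlMr//; apply: W2; rewrite -YW.
Qed.

Lemma central_interval_affine (alpha : R) : 0 < alpha < 1 ->
  [set w | central_interval P (fun w => m + s * W w) alpha (m + s * W w)] =
  [set w | central_interval P W alpha (W w)].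
Proof.
move=> /andP[a0 a1].
have pl : 0 < alpha / 2 < 1 by lra.
have pc : 0 < 1 - alpha / 2 < 1 by lra.
rewrite /central_interval !quantile_affine//.
by apply/seteqP; split => w /=; rewrite !in_itv/= !lerD2l !ler_pM2l.
Qed.

End affine_quantile.

(** * Spherical vectors *)

(** The leading nonzero term wins; for [a != 0] a root [k >= 1] satisfies [k <= (|b| + |c|) / |a|].
    In [spherical_no_atom] this shows that an outcome lies on only finitely many of the lines
    considered. *)
Lemma quadratic_neq0_near (R : realType) (a b c : R) :
  [|| a != 0, b != 0 | c != 0] ->
  \forall k \near \oo, a * k%:R ^+ 2 + b * k%:R + c != 0.
Proof.
have [->|a0 _] := eqVneq a 0; last first.
  near=> k; apply/eqP => h.
  have k1 : 1 <= k%:R :> R by near: k; exact: nbhs_infty_ger.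
  have ka : (`|b| + `|c|) / `|a| < k%:R by near: k; exact: nbhs_infty_gtr.
  have : `|a| * k%:R ^+ 2 <= (`|b| + `|c|) * k%:R.
    have -> : `|a| * k%:R ^+ 2 = `|a * k%:R ^+ 2| by rewrite normrM [`|_ ^+ 2|]ger0_norm ?exprn_ge0.
    have -> : a * k%:R ^+ 2 = - (b * k%:R + c) by lra.
    rewrite normrN (le_trans (ler_normD _ _))// mulrDl normrM.
    by rewrite (ger0_norm (ler0n R k)) lerD2l ler_peMr.
  rewrite expr2 mulrA ler_pM2r; last by lra.
  by rewrite leNgt; move: ka; rewrite ltr_pdivrMr ?normr_gt0// mulrC => ->.
have [->|b0 _] := eqVneq b 0; last first.
  near=> k; apply/eqP; rewrite mul0r add0r => h.
  have kb : `|c| / `|b| < k%:R by near: k; exact: nbhs_infty_gtr.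
  move: kb; rewrite ltr_pdivrMr ?normr_gt0// ltNge.
  suff -> : `|c| = k%:R * `|b| by rewrite lexx.
  by rewrite mulrC -[k%:R in RHS](ger0_norm (ler0n R k)) -normrM -normrN; congr `|_|; lra.
by move=> c0; apply: nearW => k; rewrite !mul0r !add0r.
Unshelve. all: by end_near. Qed.

Section truncated_moments.
Context (dT : measure_display) (T : measurableType dT) (R : realType).
Variables (P : probability T R).

Lemma integrable_boolM (b : T -> bool) (f : T -> R) : measurable_fun setT b ->
  P.-integrable setT (EFin \o f) ->
  P.-integrable setT (EFin \o (fun w => (b w)%:R * f w)).
Proof.
move=> mb fi; rewrite (_ : (fun w => _) = (fun w => f w * (b w)%:R)); last first.
  by apply/funext => w; rewrite mulrC.
apply: integrable_mulr_le1 => //.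
  by have /measurable_int/measurable_EFinP := integrable_bool P mb.
by move=> w; case: (b w); rewrite ?normr1 ?normr0.
Qed.

Lemma Lfun2_measurable (f : T -> R) : f \in Lfun P 2%:E -> measurable_fun setT f.
Proof. by rewrite inE => /andP[/[!inE]]. Qed.

Lemma Lfun2_integrable (f : T -> R) : f \in Lfun P 2%:E ->
  P.-integrable setT (EFin \o f).
Proof.
move=> f2; apply/Lfun1_integrable/(Lfun_subset12 _ f2).
by rewrite fin_num_measure.
Qed.

Lemma Lfun2_integrableM (f g : T -> R) : f \in Lfun P 2%:E -> g \in Lfun P 2%:E ->
  P.-integrable setT (EFin \o (fun w => f w * g w)).
Proof. by move=> f2 g2; apply/Lfun1_integrable; exact: Lfun2_mul_Lfun1. Qed.

Lemma measurable_norm_le (f : T -> R) c :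
  measurable_fun setT f -> measurable_fun setT (fun w => `|f w| <= c).
Proof. by move=> mf; apply: measurable_fun_ler => //; exact: measurableT_comp. Qed.

Variables (n : nat) (Z Z' : 'I_n -> T -> R).
Hypothesis Z2 : forall i, Z i \in Lfun P 2%:E.
Hypothesis Z2' : forall i, Z' i \in Lfun P 2%:E.
Hypothesis ZZ' : matched P Z Z' (fun=> 1) (fun=> 1).

Let mZ i : measurable_fun setT (Z i). Proof. exact: Lfun2_measurable. Qed.
Let mZ' i : measurable_fun setT (Z' i). Proof. exact: Lfun2_measurable. Qed.

Lemma matched_norm_le i c :
  matched P Z Z' (fun w => (`|Z i w| <= c)%R%:R) (fun w => (`|Z' i w| <= c)%R%:R).
Proof.
(* The slab is the intersection of the half-spaces [Z_i <= c] and [- Z_i <= c]. *)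
have := matchedM_le mZ mZ' (fun k => (k == i)%:R) c
  (matchedM_le mZ mZ' (fun k => -1 * (k == i)%:R) c ZZ').
apply: eq_matched => w /=; rewrite linZ lin1 mul1r mulN1r ler_norml lerNl;
  by case: (- c <= _); case: (_ <= c); rewrite /= ?mulr0 ?mulr1 ?mul0r.
Qed.

Lemma matched_moment1 i j c :
  \int[P]_w ((`|Z i w| <= c)%R%:R * Z j w) =
  \int[P]_w ((`|Z' i w| <= c)%R%:R * Z' j w).
Proof.
apply: matched_Rintegral; apply: matchedM_coord => //; first exact: matched_norm_le.
- by apply: integrable_boolM; [exact: measurable_norm_le|exact: Lfun2_integrable].
- by apply: integrable_boolM; [exact: measurable_norm_le|exact: Lfun2_integrable].
Qed.

Lemma matched_moment2 i j k c :
  \int[P]_w ((`|Z i w| <= c)%R%:R * (Z j w * Z k w)) =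
  \int[P]_w ((`|Z' i w| <= c)%R%:R * (Z' j w * Z' k w)).
Proof.
under eq_Rintegral do rewrite mulrA.
under [RHS]eq_Rintegral do rewrite mulrA.
have int2 (U : 'I_n -> T -> R) : (forall i, U i \in Lfun P 2%:E) ->
    P.-integrable setT (EFin \o (fun w => (`|U i w| <= c)%R%:R * U j w * U k w)).
  move=> U2; under eq_fun do rewrite /= -mulrA.
  apply: integrable_boolM; last exact: Lfun2_integrableM.
  exact/measurable_norm_le/Lfun2_measurable.
apply: matched_Rintegral; apply: matchedM_coord => //; try exact: int2.
apply: matchedM_coord => //; first exact: matched_norm_le.
- by apply: integrable_boolM; [exact: measurable_norm_le|exact: Lfun2_integrable].
- by apply: integrable_boolM; [exact: measurable_norm_le|exact: Lfun2_integrable].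
Qed.

End truncated_moments.

Section spherical.
Context (dT : measure_display) (T : measurableType dT) (R : realType).
Variables (P : probability T R) (n : nat) (Z : 'I_n -> T -> R).
Hypothesis Z2 : forall i, Z i \in Lfun P 2%:E.

(** The phase [s] treats the real and imaginary parts of the characteristic function at once. *)
Definition spherical := forall (t t' : 'I_n -> R) s,
  \sum_i t i ^+ 2 = \sum_i t' i ^+ 2 ->
  \int[P]_w cos (lin Z t w + s) = \int[P]_w cos (lin Z t' w + s).

Hypothesis sphZ : spherical.

Let mZ i : measurable_fun setT (Z i). Proof. exact: Lfun2_measurable. Qed.

(** [M] and [M'] stand for the transposes of the linear maps that produce [U] and [U'] from [Z]. The
    dimension [m] is free: it is [1] for projections and [n] for symmetries. *)
Lemma spherical_matched m (U U' : 'I_m -> T -> R) (M M' : ('I_m -> R) -> 'I_n -> R) :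
  (forall t w, lin U t w = lin Z (M t) w) ->
  (forall t w, lin U' t w = lin Z (M' t) w) ->
  (forall t, \sum_i M t i ^+ 2 = \sum_i M' t i ^+ 2) ->
  matched P U U' (fun=> 1) (fun=> 1).
Proof.
move=> UM UM' MM'; split; try exact: finite_measure_integrable_cst.
move=> t s.
under eq_Rintegral do rewrite mul1r UM.
under [RHS]eq_Rintegral do rewrite mul1r UM'.
exact: sphZ.
Qed.

Let marginal t t' : \sum_i t i ^+ 2 = \sum_i t' i ^+ 2 ->
  matched P (fun _ : 'I_1 => lin Z t) (fun _ : 'I_1 => lin Z t') (fun=> 1) (fun=> 1).
Proof.
move=> tt'; have lin_ord1 (v : 'I_n -> R) (r : 'I_1 -> R) w :
    lin (fun _ : 'I_1 => lin Z v) r w = lin Z (fun i => r ord0 * v i) w.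
  by rewrite linZ /lin big_ord1.
apply: (spherical_matched (lin_ord1 t) (lin_ord1 t')) => r.
by under eq_bigr do rewrite exprMn; under [RHS]eq_bigr do rewrite exprMn;
  rewrite -!mulr_sumr tt'.
Qed.

Let mlin t : measurable_fun setT (lin Z t). Proof. exact: measurable_lin. Qed.

Let lin_ord1 (U : 'I_1 -> T -> R) w : lin U (fun=> 1) w = U ord0 w.
Proof. by rewrite /lin big_ord1 mul1r. Qed.

Lemma spherical_prb_le t t' x : \sum_i t i ^+ 2 = \sum_i t' i ^+ 2 ->
  prb P (fun w => lin Z t w <= x) = prb P (fun w => lin Z t' w <= x).
Proof.
move=> /marginal tt'; apply: matched_Rintegral (eq_matched _ _ (matchedM_le _ _ (fun=> 1) x tt')) => // w.
- by rewrite lin_ord1 mul1r.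
- by rewrite lin_ord1 mul1r.
Qed.

Lemma spherical_prb_eq t t' x : \sum_i t i ^+ 2 = \sum_i t' i ^+ 2 ->
  prb P (fun w => lin Z t w == x) = prb P (fun w => lin Z t' w == x).
Proof.
move=> /marginal tt'.
have eqE (y : R) : (y <= x)%R%:R + -1 * (y < x)%R%:R = (y == x)%:R :> R.
  by case: ltgtP => _ /=; ring.
have := matchedD _ _ (matchedM_le _ _ (fun=> 1) x tt')
  (matchedZ _ _ (-1) (matchedM_lt _ _ (fun=> 1) x tt')).
move=> h; apply: matched_Rintegral (eq_matched _ _ (h _ _ _ _ _ _ _ _)) => // w.
- by rewrite !lin_ord1 !mul1r eqE.
- by rewrite !lin_ord1 !mul1r eqE.
Qed.

Let sum_unit (i : 'I_n) : \sum_k ((k == i)%:R : R) ^+ 2 = 1.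
Proof.
rewrite (bigD1 i)//= eqxx expr1n big1 ?addr0// => k /negbTE->.
by rewrite expr0n.
Qed.

Let coord_le i x :
  (fun w => Z i w <= x) = (fun w => lin Z (fun k => (k == i)%:R) w <= x).
Proof. by apply/funext => w; rewrite lin1. Qed.

Lemma spherical_prb_coord i j x :
  prb P (fun w => Z i w <= x) = prb P (fun w => Z j w <= x).
Proof. by rewrite !coord_le; apply: spherical_prb_le; rewrite !sum_unit. Qed.

Lemma spherical_prb_opp i x :
  prb P (fun w => Z i w <= x) = prb P (fun w => - Z i w <= x).
Proof.
have -> : (fun w => - Z i w <= x) = (fun w => lin Z (fun k => -1 * (k == i)%:R) w <= x).
  by apply/funext => w; rewrite linZ lin1 mulN1r.
rewrite coord_le; apply: spherical_prb_le.
by apply: eq_bigr => k _; rewrite mulN1r sqrrN.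
Qed.

(* The lines [a_k z_i + b_k z_j = u], for [(a_k, b_k)] the rational points of the
   unit circle, are tangent to a circle of radius [|u|], so each point lies on at
   most two of them; as they all have the same mass, this mass is [0]. *)
Lemma spherical_no_atom i j (u : R) : i != j -> u != 0 ->
  prb P (fun w => Z i w == u) = 0.
Proof.
move=> ij u0.
pose den (k : nat) : R := 1 + k%:R ^+ 2.
have den0 k : 0 < den k by rewrite ltr_pwDl// sqr_ge0.
pose a k : R := (1 - k%:R ^+ 2) / den k; pose b k : R := 2 * k%:R / den k.
pose th k (l : 'I_n) : R := a k * (l == i)%:R + b k * (l == j)%:R.
have thZ k w : lin Z (th k) w = a k * Z i w + b k * Z j w.
  by rewrite linD !linZ !lin1.
have th1 k : \sum_l th k l ^+ 2 = 1.
  rewrite (bigD1 i)//= (bigD1 j) 1?eq_sym//= big1 ?addr0 => [|l /andP[/negbTE li /negbTE lj]].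
    have ji : (j == i) = false by rewrite eq_sym (negbTE ij).
    rewrite /th !eqxx (negbTE ij) ji /= !mulr1 !mulr0 addr0 add0r /a /b.
    have dk : 1 + k%:R ^+ 2 != 0 :> R by rewrite lt0r_neq0// (den0 k).
    by rewrite /den; field.
  by rewrite /th li lj !mulr0 addr0 expr0n.
have e k : prb P (fun w => lin Z (th k) w == u) = prb P (fun w => Z i w == u).
  rewrite (@spherical_prb_eq (th k) (fun l => (l == i)%:R)) ?th1 ?sum_unit//.
  by congr (prb P _); apply/funext => w; rewrite lin1.
have : prb P (fun w => lin Z (th k) w == u) @[k --> \oo] --> prb P (fun=> false).
  apply: prb_cvg => [k|w]; first exact: measurable_fun_eqr.
  (* Clearing the denominator of [a_k z_i + b_k z_j = u] leaves a quadratic in [k], whose first and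
     last coefficients vanish together only if [u = 0]. *)
  have : \forall k \near \oo,
      - (Z i w + u) * k%:R ^+ 2 + 2 * Z j w * k%:R + (Z i w - u) != 0.
    apply: quadratic_neq0_near; rewrite oppr_eq0.
    have [h1|//] := eqVneq (Z i w + u) 0.
    suff -> : Z i w - u != 0 by rewrite orbT.
    by apply/eqP => h2; move/eqP : u0; apply; lra.
  apply: filterS => k; apply: contraNF => /eqP; rewrite thZ => h; apply/eqP.
  have dk := lt0r_neq0 (den0 k).
  have : (a k * Z i w + b k * Z j w) * den k = u * den k by rewrite h.
  have -> : (a k * Z i w + b k * Z j w) * den k = (1 - k%:R ^+ 2) * Z i w + 2 * k%:R * Z j w.
    by rewrite /a /b; field.
  by rewrite /den; lra.
under eq_fun do rewrite e.
by rewrite prb_false => /(cvg_unique _ (cvg_cst _)) -> //; exact: norm_hausdorff.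
Qed.

Let flip j (l : 'I_n) w := if l == j then - Z l w else Z l w.

Let matched_flip j : matched P Z (flip j) (fun=> 1) (fun=> 1).
Proof.
apply: (@spherical_matched _ _ _ id (fun t l => if l == j then - t l else t l)) => //.
- by move=> t w; apply: eq_bigr => l _; rewrite /flip; case: ifP; rewrite ?mulrN ?mulNr.
- by move=> t; apply: eq_bigr => l _; case: ifP; rewrite ?sqrrN.
Qed.

Let flip2 j l : flip j l \in Lfun P 2%:E.
Proof.
rewrite /flip; case: (l == j); last exact: Z2.
by rewrite (_ : (fun w => _) = - Z l)// rpredN.
Qed.

Let flip_norm j l w : `|flip j l w| = `|Z l w|.
Proof. by rewrite /flip; case: ifP; rewrite ?normrN. Qed.

(** Changing the sign of [Z_j] preserves the law and the event, so the integral equals its opposite.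
    The same flip gives [spherical_moment2], as it changes only one of the two factors. *)
Lemma spherical_moment1 i j c : \int[P]_w ((`|Z i w| <= c)%R%:R * Z j w) = 0.
Proof.
have := matched_moment1 Z2 (flip2 j) (matched_flip j) i j c.
under [X in _ = X]eq_Rintegral do rewrite flip_norm /flip eqxx mulrN -mulN1r.
rewrite RintegralZl//; first by lra.
by apply: integrable_boolM; [exact: measurable_norm_le|exact: Lfun2_integrable].
Qed.

Lemma spherical_moment2 i j k c : j != k ->
  \int[P]_w ((`|Z i w| <= c)%R%:R * (Z j w * Z k w)) = 0.
Proof.
move=> jk; have := matched_moment2 Z2 (flip2 j) (matched_flip j) i j k c.
under [X in _ = X]eq_Rintegral do
  rewrite flip_norm /flip eqxx eq_sym (negbTE jk) mulNr mulrN -mulN1r.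
rewrite RintegralZl//; first by lra.
by apply: integrable_boolM; [exact: measurable_norm_le|exact: Lfun2_integrableM].
Qed.

Lemma spherical_perm (s : {perm 'I_n}) : matched P Z (fun l => Z (s l)) (fun=> 1) (fun=> 1).
Proof.
apply: (@spherical_matched _ _ _ id (fun t l => t ((s^-1)%g l))) => //.
- move=> t w; rewrite /lin [RHS](reindex_inj (@perm_inj _ s))/=.
  by apply: eq_bigr => l _; rewrite permK.
- by move=> t; rewrite [LHS](reindex_inj (@perm_inj _ (s^-1)%g)).
Qed.

Lemma spherical_moment_perm (s : {perm 'I_n}) i j c :
  \int[P]_w ((`|Z i w| <= c)%R%:R * (Z j w * Z j w)) =
  \int[P]_w ((`|Z (s i) w| <= c)%R%:R * (Z (s j) w * Z (s j) w)).
Proof. exact: (matched_moment2 Z2 (fun l => Z2 (s l)) (spherical_perm s)). Qed.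

Lemma spherical_moment_diag i i' c :
  \int[P]_w ((`|Z i w| <= c)%R%:R * (Z i w * Z i w)) =
  \int[P]_w ((`|Z i' w| <= c)%R%:R * (Z i' w * Z i' w)).
Proof. by rewrite (spherical_moment_perm (tperm i i')) tpermL. Qed.

Lemma spherical_moment_offdiag i j i' j' c : i != j -> i' != j' ->
  \int[P]_w ((`|Z i w| <= c)%R%:R * (Z j w * Z j w)) =
  \int[P]_w ((`|Z i' w| <= c)%R%:R * (Z j' w * Z j' w)).
Proof.
move=> ij ij'; rewrite (spherical_moment_perm (tperm i i')) tpermL.
(* The first transposition brings [i] to [i']. The second brings the image [k] of [j] to [j'] and
   fixes [i'], which differs from both [k] and [j']. *)
set k := tperm i i' j; rewrite (spherical_moment_perm (tperm k j')) tpermL tpermD//.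
  by rewrite /k -[X in _ != X](tpermL i i') (inj_eq perm_inj) eq_sym.
by rewrite eq_sym.
Qed.

Lemma spherical_prb_norm i i' c :
  prb P (fun w => `|Z i w| <= c) = prb P (fun w => `|Z i' w| <= c).
Proof.
have := matched_norm_le Z2 (fun l => Z2 (tperm i i' l)) (spherical_perm (tperm i i')) i c.
by move=> /matched_Rintegral; rewrite tpermL.
Qed.

(* By symmetry the claim compares [E(Z_i^2; |Z_i| <= c)] with
   [E(Z_i^2; |Z_j| <= c)], and [(Z_i^2 - c^2) (1_{|Z_j| <= c} - 1_{|Z_i| <= c})]
   is nonnegative. *)
Lemma spherical_moment_le i j c : i != j ->
  \int[P]_w ((`|Z i w| <= c)%R%:R * (Z i w * Z i w)) <=
  \int[P]_w ((`|Z i w| <= c)%R%:R * (Z j w * Z j w)).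
Proof.
move=> ij; have ji : j != i by rewrite eq_sym.
rewrite (spherical_moment_offdiag c ij ji).
have mb k : measurable_fun setT (fun w => `|Z k w| <= c) by exact: measurable_norm_le.
have i2 k l : P.-integrable setT
    (EFin \o (fun w => (`|Z k w| <= c)%R%:R * (Z l w * Z l w))).
  by apply: integrable_boolM => //; exact: Lfun2_integrableM.
have ic k : P.-integrable setT (EFin \o (fun w => c ^+ 2 * (`|Z k w| <= c)%R%:R)).
  exact: (integrableZl measurableT (c ^+ 2) (integrable_bool P (mb k))).
have ec k : \int[P]_w (c ^+ 2 * (`|Z k w| <= c)%R%:R) = c ^+ 2 * prb P (fun w => `|Z k w| <= c).
  by rewrite RintegralZl//; exact: integrable_bool.
(* The pointwise inequality is rearranged so that no term is subtracted. After integration the two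
   [c ^+ 2] terms agree by [spherical_prb_norm] and cancel. *)
have : \int[P]_w ((`|Z i w| <= c)%R%:R * (Z i w * Z i w) + c ^+ 2 * (`|Z j w| <= c)%R%:R) <=
       \int[P]_w ((`|Z j w| <= c)%R%:R * (Z i w * Z i w) + c ^+ 2 * (`|Z i w| <= c)%R%:R).
  apply: le_Rintegral => //.
  - exact: (integrableD measurableT (i2 i i) (ic j)).
  - exact: (integrableD measurableT (i2 j i) (ic i)).
  move=> w _; rewrite -expr2 -(real_normK (num_real (Z i w))).
  have z0 : 0 <= `|Z i w| by [].
  have z0' : 0 <= `|Z j w| by [].
  by case: (leP `|Z i w| c) => h; case: (leP `|Z j w| c) => h' /=; nra.
rewrite !RintegralD// !ec (spherical_prb_norm j i).
by rewrite lerD2r.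
Qed.

End spherical.

(** * Diagonal matrices *)

Section diagonal_matrices.
Context {R : realType} (n : nat).
Implicit Types D : 'rV[R]_n.

Lemma frob_norm_diag D : frob_norm (diag_mx D) = Num.sqrt (\sum_i D 0 i ^+ 2).
Proof.
congr Num.sqrt; apply: eq_bigr => i _; rewrite (bigD1 i)//= big1 => [|j ji].
  by rewrite addr0 mxE eqxx mulr1n.
by rewrite mxE eq_sym (negbTE ji) mulr0n expr0n.
Qed.

Lemma vnorm_diag D (x : 'cV[R]_n) :
  vnorm (diag_mx D *m x) = Num.sqrt (\sum_i (D 0 i * x i 0) ^+ 2).
Proof.
by congr Num.sqrt; apply: eq_bigr => i _; rewrite mul_diag_mx !mxE expr2.
Qed.

Lemma vnorm_eq1 (x : 'cV[R]_n) : vnorm x = 1 -> \sum_i x i 0 ^+ 2 = 1.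
Proof.
move=> x1; rewrite -(expr1n _ 2) -x1 sqr_sqrtr; last first.
  by apply: sumr_ge0 => i _; rewrite -expr2 sqr_ge0.
by apply: eq_bigr => i _; rewrite expr2.
Qed.

Lemma vnorm_delta i : vnorm (delta_mx i 0 : 'cV[R]_n) = 1.
Proof.
rewrite /vnorm /dotv (bigD1 i)//= big1 => [|j ji].
  by rewrite mxE !eqxx mulr1 addr0 sqrtr1.
by rewrite mxE (negbTE ji) mul0r.
Qed.

Lemma vnorm_diag_le D M (x : 'cV[R]_n) : (forall i, 0 <= D 0 i <= M) -> 0 <= M ->
  vnorm x = 1 -> vnorm (diag_mx D *m x) <= M.
Proof.
move=> DM M0 /vnorm_eq1 x1; rewrite vnorm_diag -[leRHS](ger0_norm M0) -sqrtr_sqr.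
apply: ler_wsqrtr; rewrite -[leRHS]mulr1 -x1 mulr_sumr; apply: ler_sum => i _.
rewrite exprMn; apply: ler_wpM2r; first exact: sqr_ge0.
by have /andP[D0 D1] := DM i; rewrite ler_sqr.
Qed.

(** The index [i0] makes the unit sphere nonempty, so that [sup] is a genuine supremum, and yields
    [0 <= M]. *)
Lemma op_norm_diag_le D M (i0 : 'I_n) : (forall i, 0 <= D 0 i <= M) ->
  op_norm (diag_mx D) <= M.
Proof.
move=> DM; have M0 : 0 <= M by have /andP[] := DM i0; exact: le_trans.
apply: ge_sup => [|_ [x /= x1 <-]]; last exact: vnorm_diag_le.
by exists (vnorm (diag_mx D *m delta_mx i0 0)); exists (delta_mx i0 0) => //=; exact: vnorm_delta.
Qed.

Lemma op_norm_diag D (i0 : 'I_n) : (forall i, 0 <= D 0 i <= D 0 i0) ->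
  op_norm (diag_mx D) = D 0 i0.
Proof.
move=> DM; apply/eqP; rewrite eq_le op_norm_diag_le//=.
have /andP[D0 _] := DM i0.
apply: ub_le_sup; first by exists (D 0 i0) => _ [x /= x1 <-]; exact: vnorm_diag_le.
exists (delta_mx i0 0); first exact: vnorm_delta.
rewrite vnorm_diag (bigD1 i0)//= big1 => [|j ji].
  by rewrite mxE !eqxx mulr1 addr0 sqrtr_sqr ger0_norm.
by rewrite mxE (negbTE ji) mulr0 expr0n.
Qed.

Variables (lam : 'I_n -> R) (a b : R).
Hypothesis lam_mono : forall i j : 'I_n, (i <= j)%N -> lam j <= lam i.
Hypothesis lam_gt0 : forall i, 0 < lam i.
Hypothesis a_ge0 : 0 <= a.
Hypothesis a_le_b : a <= b.

(** The diagonal of the conditional covariance given coordinate [i]: its own variance is scaled by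
    [a], every other one by [b]. *)
Definition spiked i : 'rV[R]_n := \row_j (lam j * (if j == i then a else b)).

Let b_ge0 : 0 <= b. Proof. exact: le_trans a_le_b. Qed.

(** Only the subtracted term depends on [i], and it grows with [lam i] since [0 <= a <= b]; this
    orders the norms. *)
Lemma frob_norm_spiked i :
  frob_norm (diag_mx (spiked i)) =
  Num.sqrt (\sum_j (lam j * b) ^+ 2 - lam i ^+ 2 * (b ^+ 2 - a ^+ 2)).
Proof.
rewrite frob_norm_diag; congr Num.sqrt; rewrite (bigD1 i)//= [in RHS](bigD1 i)//=.
rewrite mxE eqxx (eq_bigr (fun j => (lam j * b) ^+ 2)) => [|j /negbTE ji]; first by ring.
by rewrite mxE ji.
Qed.

Lemma frob_norm_spiked_le i j : lam j <= lam i ->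
  frob_norm (diag_mx (spiked i)) <= frob_norm (diag_mx (spiked j)).
Proof.
move=> ji; rewrite !frob_norm_spiked; apply: ler_wsqrtr; rewrite lerD2l lerN2.
apply: ler_wpM2r; first by rewrite subr_ge0 ler_sqr.
by rewrite ler_sqr ?nnegrE //; exact: ltW.
Qed.

Lemma det_spiked i : \det (diag_mx (spiked i)) = (\prod_j lam j) * (a * b ^+ n.-1).
Proof.
rewrite det_diag; under eq_bigr do rewrite mxE.
rewrite big_split/=; congr (_ * _); rewrite (bigD1 i)//= eqxx; congr (_ * _).
rewrite (eq_bigr (fun=> b)) => [|j /negbTE->//].
by rewrite prodr_const cardC1 card_ord.
Qed.

Lemma spiked_itv i i1 j : nat_of_ord i1 = 0%N -> 0 <= spiked i 0 j <= lam i1 * b.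
Proof.
move=> i10; have l1 : lam j <= lam i1 by apply: lam_mono; rewrite i10.
have lj := ltW (lam_gt0 j).
by rewrite mxE; case: ifP => _; rewrite mulr_ge0//= ler_pM//.
Qed.

(** When the spike is elsewhere, the entry at [i1] keeps the factor [b] and thus dominates all
    others, whatever [i] is. *)
Lemma op_norm_spiked i i1 : nat_of_ord i1 = 0%N -> i != i1 ->
  op_norm (diag_mx (spiked i)) = lam i1 * b.
Proof.
move=> i10 ii1; have e : spiked i 0 i1 = lam i1 * b by rewrite mxE eq_sym (negbTE ii1).
by rewrite (@op_norm_diag _ i1) e// => j; exact: spiked_itv.
Qed.

Lemma op_norm_spiked_le i i1 : nat_of_ord i1 = 0%N ->
  op_norm (diag_mx (spiked i1)) <= op_norm (diag_mx (spiked i)).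
Proof.
move=> i10; have [->//|ii1] := eqVneq i i1.
rewrite (op_norm_spiked i10 ii1); apply: (op_norm_diag_le i1) => j.
exact: spiked_itv.
Qed.

End diagonal_matrices.

(** * Conditional covariance of an elliptical vector *)

Section conditional_covariance.
Context (dT : measure_display) (T : measurableType dT) (R : realType).
Variables (P : probability T R) (A : set T) (b : T -> bool).
Hypothesis mA : measurable A.
Hypothesis mb : measurable_fun setT b.
Hypothesis Ab : {ae P, forall w, A w <-> b w}.

Lemma condE_ae (f : T -> R) : measurable_fun setT f ->
  condE P A f = \int[P]_w ((b w)%:R * f w) / prb P b.
Proof.
move=> mf; rewrite /condE.
have mbR : measurable_fun setT (fun w => (b w)%:R : R).
  by have /measurable_int/measurable_EFinP := integrable_bool P mb.
have ae_indic : {ae P, forall w, \1_A w = (b w)%:R :> R}.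
  apply: filterS Ab => w Abw; rewrite indicE; congr ((nat_of_bool _)%:R).
  by apply/idP/idP; rewrite inE => /Abw.
congr (fine _ / _).
- rewrite unlock; apply: ae_eq_integral => //.
  + by apply/measurable_EFinP/measurable_funM.
  + by apply/measurable_EFinP/measurable_funM.
  + by apply: filterS ae_indic => w e _ /=; rewrite e mulrC.
- rewrite /prb /Rintegral; congr fine.
  rewrite -[in LHS](setIT A) -integral_indic//; apply: ae_eq_integral => //.
  + exact/measurable_EFinP.
  + exact/measurable_EFinP.
  + by apply: filterS ae_indic => w e _ /=; rewrite e.
Qed.

Variables (U U' : T -> R) (m m' s s' : R).
Hypothesis U2 : U \in Lfun P 2%:E.
Hypothesis U2' : U' \in Lfun P 2%:E.
Hypothesis bU : \int[P]_w ((b w)%:R * U w) = 0.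
Hypothesis bU' : \int[P]_w ((b w)%:R * U' w) = 0.

Lemma condcov_affine :
  condcov P A (fun w => m + s * U w) (fun w => m' + s' * U' w) =
  s * s' * (\int[P]_w ((b w)%:R * (U w * U' w)) / prb P b).
Proof.
have mU := Lfun2_measurable U2; have mU' := Lfun2_measurable U2'.
have maff (f : T -> R) (c r : R) : measurable_fun setT f ->
    measurable_fun setT (fun w => c + r * f w).
  by move=> mf; apply: measurable_funD => //; exact: measurable_funM.
have Zint (c : R) (f : T -> R) : P.-integrable setT (EFin \o f) ->
    P.-integrable setT (EFin \o (fun w => c * f w)).
  by move=> fi; exact: (integrableZl measurableT c fi).
have ib := integrable_bool P mb.
have ibU := integrable_boolM mb (Lfun2_integrable U2).
have ibU' := integrable_boolM mb (Lfun2_integrable U2').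
have ibUU := integrable_boolM mb (Lfun2_integrableM U2 U2').
have e1 (f : T -> R) (c r : R) :
    P.-integrable setT (EFin \o (fun w => (b w)%:R * f w)) ->
    \int[P]_w ((b w)%:R * f w) = 0 ->
    \int[P]_w ((b w)%:R * (c + r * f w)) = c * prb P b.
  move=> fi f0.
  have dist w : (b w)%:R * (c + r * f w) = c * (b w)%:R + r * ((b w)%:R * f w) by ring.
  under eq_Rintegral do rewrite dist.
  by rewrite RintegralD ?RintegralZl ?f0 ?mulr0 ?addr0//; exact: Zint.
have e2 : \int[P]_w ((b w)%:R * ((m + s * U w) * (m' + s' * U' w))) =
    m * m' * prb P b + s * s' * \int[P]_w ((b w)%:R * (U w * U' w)).
  have dist w : (b w)%:R * ((m + s * U w) * (m' + s' * U' w)) =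
      (m * m' * (b w)%:R + s * s' * ((b w)%:R * (U w * U' w))) +
      (m * s' * ((b w)%:R * U' w) + m' * s * ((b w)%:R * U w)) by ring.
  under eq_Rintegral do rewrite dist.
  have i1 : P.-integrable setT (EFin \o
      (fun w => m * m' * (b w)%:R + s * s' * ((b w)%:R * (U w * U' w)))).
    exact: (integrableD measurableT (Zint _ _ ib) (Zint _ _ ibUU)).
  have i2 : P.-integrable setT (EFin \o
      (fun w => m * s' * ((b w)%:R * U' w) + m' * s * ((b w)%:R * U w))).
    exact: (integrableD measurableT (Zint _ _ ibU') (Zint _ _ ibU)).
  rewrite (RintegralD measurableT i1 i2).
  rewrite (RintegralD measurableT (Zint _ _ ib) (Zint _ _ ibUU)).
  rewrite (RintegralD measurableT (Zint _ _ ibU') (Zint _ _ ibU)).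
  by rewrite !RintegralZl// bU bU' !mulr0 !addr0.
rewrite /condcov !condE_ae; [|exact: maff|exact: maff|by apply: measurable_funM; exact: maff].
rewrite /= e2 !e1//.
(* For a null event the inverse is [0] and both sides vanish; otherwise the products of the means
   cancel. *)
have [->|p0] := eqVneq (prb P b) 0; first by rewrite invr0 !mulr0 subr0.
by field.
Qed.

End conditional_covariance.

(** * Standardization by the spectral decomposition *)

Section spectral.
Context {R : realType} (n : nat) (V : 'M[R]_n) (lam : 'I_n -> R).
Hypothesis V_orth : V^T *m V = 1%:M.
Hypothesis lam_gt0 : forall i, 0 < lam i.

Lemma dotvE m (u v : 'cV[R]_m) : dotv u v = (u^T *m v) 0 0.
Proof. by rewrite mxE; apply: eq_bigr => i _; rewrite mxE. Qed.

(** The vector [tau] is [V Lambda^(-1/2) t], chosen to turn the quadratic form of [Sigma] into the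
    squared norm of [t]. *)
Lemma dotv_spectral (t : 'I_n -> R) :
  let tau := V *m \col_i (t i / Num.sqrt (lam i)) in
  dotv tau (V *m diag_mx (\row_i lam i) *m V^T *m tau) = \sum_i t i ^+ 2.
Proof.
set c := \col_i _ => tau; rewrite dotvE trmx_mul.
have -> : c^T *m V^T *m (V *m diag_mx (\row_i lam i) *m V^T *m tau) =
    c^T *m (V^T *m V) *m diag_mx (\row_i lam i) *m (V^T *m V) *m c.
  by rewrite /tau !mulmxA.
rewrite V_orth !mulmx1 -mulmxA mxE; apply: eq_bigr => i _.
rewrite mul_diag_mx !mxE.
have l0 := lam_gt0 i; have s0 : Num.sqrt (lam i) != 0 by rewrite sqrtr_eq0 -ltNge.
by rewrite -{2}(sqr_sqrtr (ltW l0)); field.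
Qed.

End spectral.

Section elliptical.
Context (dT : measure_display) (T : measurableType dT) (R : realType).
Variables (P : probability T R) (n : nat) (X : 'I_n -> T -> R).
Variables (mu : 'cV[R]_n) (V : 'M[R]_n) (lam : 'I_n -> R) (phr phi : R -> R).
Hypothesis X2 : forall i, X i \in Lfun P 2%:E.
Hypothesis V_orth : V^T *m V = 1%:M.
Hypothesis lam_gt0 : forall i, 0 < lam i.
Hypothesis ellX : elliptical P X mu (V *m diag_mx (\row_i lam i) *m V^T) phr phi.

Let m i : R := \sum_(j < n) V j i * mu j 0.

(** The vector [Lambda^(-1/2) V' (X - mu)], centred at the location parameter. *)
Definition standardized (i : 'I_n) (w : T) : R :=
  (\sum_(j < n) V j i * X j w - m i) / Num.sqrt (lam i).

Let tau (t : 'I_n -> R) := V *m \col_i (t i / Num.sqrt (lam i)).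

Lemma lin_standardized t w :
  lin standardized t w = dotv (tau t) (rvec X w) - dotv (tau t) mu.
Proof.
rewrite /dotv -sumrB /lin /standardized /m /tau.
under eq_bigr => i _.
  rewrite -sumrB mulrA mulrAC mulr_sumr; over.
rewrite exchange_big/=; apply: eq_bigr => j _.
rewrite -mulrBr mxE mulr_suml; apply: eq_bigr => i _.
by rewrite !mxE; ring.
Qed.

Lemma measurable_rvec_dotv u : measurable_fun setT (fun w => dotv u (rvec X w)).
Proof.
apply: measurable_sum => j; apply: measurable_funM => //.
by under eq_fun do rewrite mxE; exact: Lfun2_measurable.
Qed.

(** Centring shifts the phase by [- mt], which cancels the factor [exp (i mt)] of the characteristic
    function; what remains depends on the norm of [t] only. *)
Lemma Rintegral_cos_elliptical t s :
  \int[P]_w cos (lin standardized t w + s) =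
  cos s * phr (\sum_i t i ^+ 2) - sin s * phi (\sum_i t i ^+ 2).
Proof.
have [] := ellX (tau t); rewrite /= dotv_spectral//.
set q := \sum_i _; set mt := dotv (tau t) mu => ec es.
have expand w : cos (lin standardized t w + s) =
   cos (s - mt) * cos (dotv (tau t) (rvec X w)) - sin (s - mt) * sin (dotv (tau t) (rvec X w)).
  rewrite lin_standardized -/mt.
  by rewrite addrAC -addrA (cosD (dotv _ _)) mulrC [sin (dotv _ _) * _]mulrC.
under eq_Rintegral do rewrite expand.
have md := measurable_rvec_dotv (tau t).
have ci : P.-integrable setT (EFin \o (fun w => cos (dotv (tau t) (rvec X w)))).
  rewrite (_ : (fun w => _) = (fun w => 1 * cos (dotv (tau t) (rvec X w)))).
    apply: integrable_mulr_le1; first exact: finite_measure_integrable_cst.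
      exact: measurable_fun_cos.
    by move=> w; exact: cos_max.
  by apply/funext => w; rewrite mul1r.
have si : P.-integrable setT (EFin \o (fun w => sin (dotv (tau t) (rvec X w)))).
  rewrite (_ : (fun w => _) = (fun w => 1 * sin (dotv (tau t) (rvec X w)))).
    apply: integrable_mulr_le1; first exact: finite_measure_integrable_cst.
      under eq_fun do rewrite -cosBpihalf.
      by apply/measurable_fun_cos/measurable_funD.
    by move=> w; exact: sin_max.
  by apply/funext => w; rewrite mul1r.
rewrite RintegralB//; last 2 first.
  exact: (integrableZl measurableT _ ci).
  exact: (integrableZl measurableT _ si).
rewrite !RintegralZl// /Rintegral ec es /= cosB sinB.
have := cos2Dsin2 mt; set C := cos mt; set S := sin mt => h.
transitivity ((C ^+ 2 + S ^+ 2) * (cos s * phr q - sin s * phi q)); first by ring.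
by rewrite h mul1r.
Qed.

Lemma spherical_standardized : spherical P standardized.
Proof. by move=> t t' s tt'; rewrite !Rintegral_cos_elliptical tt'. Qed.

Lemma standardized_Lfun2 i : standardized i \in Lfun P 2%:E.
Proof.
rewrite (_ : standardized i = \sum_j ((V j i / Num.sqrt (lam i)) *: X j) +
   cst (- m i / Num.sqrt (lam i))); last first.
  apply/funext => w; rewrite /standardized fctE fct_sumE mulrDl mulr_suml.
  by congr (_ + _); apply: eq_bigr => j _; rewrite mulrAC.
have [L0 Llin] := Lfun_submod_closed P (@lee1n R 2).
rewrite -[X in X + _]scale1r; apply: (Llin 1); last exact: Lfun_cst.
apply: (big_rec (fun f => f \in Lfun P 2%:E)) => [//|j f _ fL]; exact: Llin.
Qed.

Lemma standardizedK i w :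
  \sum_(j < n) V j i * X j w = m i + Num.sqrt (lam i) * standardized i w.
Proof.
have s0 : Num.sqrt (lam i) != 0 by rewrite sqrtr_eq0 -ltNge.
by rewrite /standardized mulrC divfK// addrC subrK.
Qed.

Lemma condcov_elliptical (alpha : R) : (2 <= n)%N -> 0 < alpha < 1 ->
  exists a b : R, [/\ 0 <= a, a <= b & forall i,
    condcov_mx P (fun i w => \sum_(j < n) V j i * X j w)
      [set w | central_interval P (fun w => \sum_(j < n) V j i * X j w) alpha
                 (\sum_(j < n) V j i * X j w)] =
    diag_mx (spiked lam a b i)].
Proof.
move=> n2 al.
pose i0 := Ordinal (ltnW n2); pose j0 := Ordinal n2.
have ij0 : i0 != j0 by [].
pose Z := standardized; pose c := quantile P (Z i0) (1 - alpha / 2).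
have Z2 := standardized_Lfun2; have sphZ := spherical_standardized.
have mZ i : measurable_fun setT (Z i) by exact: Lfun2_measurable.
have pc : 0 < 1 - alpha / 2 < 1 by move/andP: al => [? ?]; lra.
have qc i : quantile P (Z i) (1 - alpha / 2) = c.
  rewrite /c /quantile !quantile_setE//; congr inf; apply/seteqP.
  by split=> x /=; rewrite (spherical_prb_coord Z2 sphZ i i0).
pose p := prb P (fun w => `|Z i0 w| <= c).
have pE i : prb P (fun w => `|Z i w| <= c) = p by exact: spherical_prb_norm.
pose I i j := \int[P]_w ((`|Z i w| <= c)%R%:R * (Z j w * Z j w)).
(* Excluding atoms of [Z i] requires a second coordinate, available as [n >= 2]. *)
have ex (i : 'I_n) : exists j, i != j.
  by have [->|ii0] := eqVneq i i0; [exists j0|exists i0].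
have ae i : {ae P, forall w, central_interval P (Z i) alpha (Z i w) <-> `|Z i w| <= c}.
  rewrite -(qc i); apply: central_interval_sym => //.
    exact: spherical_prb_opp.
  by move=> u u0; have [j ij] := ex i; exact: (spherical_no_atom Z2 sphZ ij u0).
have p0 : 0 <= p by exact: prb_ge0.
(* The conditional second moments of [Z i0] and [Z j0] given [|Z i0| <= c]. *)
exists (I i0 i0 / p), (I i0 j0 / p); split.
- rewrite divr_ge0//; apply: Rintegral_ge0 => w _.
  by rewrite mulr_ge0// -expr2 sqr_ge0.
- by apply: ler_wpM2r; [rewrite invr_ge0|exact: spherical_moment_le].
move=> i.
have YE k : (fun w => \sum_(j < n) V j k * X j w) = (fun w => m k + Num.sqrt (lam k) * Z k w).
  by apply/funext => w; rewrite standardizedK.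
set A := [set w | _].
have AE : A = [set w | central_interval P (Z i) alpha (Z i w)].
  rewrite /A -(@central_interval_affine _ _ _ P (Z i) (m i) (Num.sqrt (lam i)))//.
    by rewrite YE; apply/seteqP; split=> w /=; rewrite standardizedK.
  by rewrite sqrtr_gt0.
have mA : measurable A.
  rewrite AE -[X in measurable X]setTI; apply: (mZ i) => //.
  exact: measurable_itv.
have aeA : {ae P, forall w, A w <-> `|Z i w| <= c} by rewrite AE; exact: ae.
apply/matrixP => j k; rewrite !mxE !YE.
rewrite (condcov_affine mA _ aeA); last 5 first.
- exact: measurable_norm_le.
- exact: Z2.
- exact: Z2.
- exact: spherical_moment1.
- exact: spherical_moment1.
rewrite pE; have [<-|jk] := eqVneq j k; last by rewrite mulr0n (spherical_moment2 Z2 sphZ)// mul0r mulr0.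
rewrite mulr1n -expr2 sqr_sqrtr ?(ltW (lam_gt0 j))//.
have [->|ji] := eqVneq j i; congr (_ * (_ / _)); first exact: spherical_moment_diag.
by apply: spherical_moment_offdiag; rewrite // eq_sym.
Qed.

End elliptical.

Theorem theorem9 (R : realType) (dT : measure_display) (T : measurableType dT)
    (P : probability T R) (d : nat) (hd : (2 <= d)%N)
    (X : 'I_d -> {RV P >-> R})
    (mu : 'cV[R]_d) (Sigma : 'M[R]_d) (phr phi : R -> R)
    (V : 'M[R]_d) (lam : 'I_d -> R) (alpha : R) :
  (* finite second moments *)
  (forall i, (X i : T -> R) \in Lfun P 2%E) ->
  (* X elliptical with parameters (mu, Sigma, phi) *)
  elliptical P (fun i => (X i : T -> R)) mu Sigma phr phi ->
  (* Sigma is the covariance matrix of X *)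
  (forall i j, covariance P (X i) (X j) = (Sigma i j)%:E) ->
  (* spectral decomposition Sigma = V Lambda V', V orthogonal,
     lam_1 >= ... >= lam_d > 0 (so Sigma is positive definite) *)
  V^T *m V = 1%:M ->
  Sigma = V *m diag_mx (\row_i lam i) *m V^T ->
  (forall i j : 'I_d, (i <= j)%N -> lam j <= lam i) ->
  (forall i, 0 < lam i) ->
  0 < alpha < 1 ->
  let Y := fun (i : 'I_d) (w : T) => \sum_(j < d) V j i * X j w in
  let Lam := fun i : 'I_d =>
    condcov_mx P Y [set w | central_interval P (Y i) alpha (Y i w)] in
  forall i1 id : 'I_d, nat_of_ord i1 = 0%N -> nat_of_ord id = d.-1 ->
  (* (1) *)
  (forall i, frob_norm (Lam i1) <= frob_norm (Lam i) <= frob_norm (Lam id)) /\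
  (* (2) *)
  (forall i j, \det (Lam i) = \det (Lam j)) /\
  (* (3) *)
  (forall i, op_norm (Lam i1) <= op_norm (Lam i)) /\
  (forall i j : 'I_d, (1 <= i)%N -> (1 <= j)%N -> op_norm (Lam i) = op_norm (Lam j)).
Proof.
move=> X2 ellX _ V_orth SigmaE lam_mono lam_gt0 al Y Lam i1 id i10 idd.
rewrite SigmaE in ellX.
have [a [b [a0 ab LamE']]] := condcov_elliptical X2 V_orth lam_gt0 ellX hd al.
have LamE i : Lam i = diag_mx (spiked lam a b i) := LamE' i.
split; [|split; [|split]].
- move=> i; rewrite !LamE !frob_norm_spiked_le//; apply: lam_mono.
    by rewrite idd -ltnS (ltn_predK hd).
  by rewrite i10.
- by move=> i j; rewrite !LamE !det_spiked.
- by move=> i; rewrite !LamE; exact: op_norm_spiked_le.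
- move=> i j i_gt0 j_gt0; rewrite !LamE.
  (* Indices that are at least [1] differ from [i1], whose value is [0]. *)
  by rewrite !(@op_norm_spiked _ _ _ _ _ lam_mono lam_gt0 a0 ab _ i1 i10)//;
    apply: contraTneq isT => e; move: i_gt0 j_gt0; rewrite ?e i10.
Qed.
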